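(* Let $\mathfrak g$ be a finite-dimensional complex semisimple Lie algebra with a fixed Cartan involution $X\mapsto X^*$. Then for every $A\in\mathfrak g$ satisfying $A=A^*$ there exists $Y\in\mathfrak g$ such that $A=[Y^*,Y]$.
   Context: A finite-dimensional complex Lie algebra $\mathfrak g$ is semisimple if and only if its Killing form $B_{\mathfrak g}(X,Y)=\mathrm{Tr}((\mathrm{ad}_{\mathfrak g}X)(\mathrm{ad}_{\mathfrak g}Y))$ is nondegenerate, where $(\mathrm{ad}_{\mathfrak g}X)Y=[X,Y]$. Here a Cartan involution on a complex semisimple Lie algebra $\mathfrak g$ means a conjugate-linear mapping $\mathfrak g\to\mathfrak g$, $X\mapsto X^*$, such that for all $X,Y\in\mathfrak g$ one has $(X^* )^*=X$, $[X,Y]^*=[Y^*,X^*]$ and $B_{\mathfrak g}(X,X^* )\ge 0$. (The usual convention reserves this name for the mapping $X\mapsto -X^*$.) *)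

(* Defs.v *)
From HB Require Import structures.
From mathcomp Require Import all_boot all_order all_algebra.
From mathcomp Require Import reals.
From mathcomp Require Export complex.

Set Implicit Arguments.
Unset Strict Implicit.
Unset Printing Implicit Defensive.

Import GRing.Theory.
Local Open Scope ring_scope.

(* Redundant presentation: linearity in the second argument follows from the
   other axioms. *)
HB.mixin Record isLieAlgebra (K : fieldType) (g : Type) of Vector K g := {
  lie_bracket : g -> g -> g;
  lie_bracket_linearl : forall Y : g, linear (lie_bracket^~ Y);
  lie_bracket_linearr : forall X : g, linear (lie_bracket X);
  lie_bracketxx : forall X : g, lie_bracket X X = 0;
  lie_jacobi : forall X Y Z : g,
    lie_bracket X (lie_bracket Y Z) + lie_bracket Y (lie_bracket Z X)
      + lie_bracket Z (lie_bracket X Y) = 0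
}.

#[short(type="lieAlgType")]
HB.structure Definition LieAlgebra (K : fieldType) :=
  {g of isLieAlgebra K g & Vector K g}.

Reserved Notation "[[ X , Y ]]" (at level 0, format "[[ X ,  Y ]]").
Notation "[[ X , Y ]]" := (lie_bracket X Y) : ring_scope.

Section LieAlgebraTheory.
Variables (K : fieldType) (g : lieAlgType K).

HB.instance Definition _ (X : g) :=
  GRing.isLinear.Build K g g *:%R (lie_bracket X) (lie_bracket_linearr X).

Definition ad (X : g) : 'End(g) := linfun (lie_bracket X).

Lemma adE (X Y : g) : ad X Y = [[X, Y]].
Proof. exact: lfunE. Qed.

Definition lfun_trace (f : 'End(g)) : K :=
  \tr (passmx.mxof (vbasis {:g}) (vbasis {:g}) f).

Definition killing_form (X Y : g) : K := lfun_trace (ad X \o ad Y)%VF.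

End LieAlgebraTheory.

Section ComplexLieAlgebra.
Variables (R : realType) (g : lieAlgType R[i]).

(* Cartan's criterion, taken as the definition. *)
Definition semisimple : Prop :=
  forall X : g, (forall Y : g, killing_form X Y = 0) -> X = 0.

(* No minus sign: with the usual convention the Cartan involution is
   [X |-> - star X].  In [R[i]], [0 <= z] says that [z] is real and
   nonnegative. *)
Record cartan_involution (star : g -> g) : Prop := CartanInvolution {
  star_conj_linear : linear_for (@conjc R \; *:%R) star;
  starK : involutive star;
  star_bracket : forall X Y : g, star [[X, Y]] = [[star Y, star X]];
  killing_star_ge0 : forall X : g, 0 <= killing_form X (star X)
}.

End ComplexLieAlgebra.

Arguments semisimple {R} g.

(* Main.v *)
(* Embed A in a maximal abelian subspace U stable under star.  The operators
   ad H, H in U, are commuting and normal for the Hermitian product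
   B(X, Y^* ), so g has a joint eigenbasis (v_k); the weight of v_k is H |->
   B(H, h_k) with h_k = [v_k, v_k^*] / B(v_k, v_k^* ), a self-adjoint element of
   U.  Choose the positive roots so that A is dominant.  Differences of distinct
   simple roots are not roots, so [v_i, v_j^*] = 0 for simple i <> j, and hence
   B(h_i, h_j) <= 0.  A dominant vector in the span of an obtuse family is a
   nonnegative combination of it, so A = sum_k c_k h_k over the simple k with
   c_k >= 0, and Y = sum_k sqrt(c_k / B(v_k, v_k^* )) v_k^* works. *)

Require Import Defs.
From HB Require Import structures.
From mathcomp Require Import all_boot all_order all_algebra.
From mathcomp Require Import reals complex.
From mathcomp Require Import ring.

Set Implicit Arguments.
Unset Strict Implicit.
Unset Printing Implicit Defensive.

Import Order.TTheory GRing.Theory Num.Theory.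
Import passmx.
Local Open Scope ring_scope.

(** * Symmetry and invariance of the Killing form *)

Section KillingForm.
Variables (K : fieldType) (g : lieAlgType K).
Implicit Types X Y Z : g.

Lemma lie_bracketC X Y : [[X, Y]] = - [[Y, X]].
Proof.
have := lie_bracketxx (X + Y); rewrite linearD /=.
have lD Z1 Z2 Z : [[Z1 + Z2, Z]] = [[Z1, Z]] + [[Z2, Z]].
  by have := lie_bracket_linearl Z 1 Z1 Z2; rewrite !scale1r.
rewrite !lD !lie_bracketxx add0r addr0 addrC => /eqP.
by rewrite addr_eq0 => /eqP.
Qed.

Lemma lie_bracketDl X Y Z : [[X + Y, Z]] = [[X, Z]] + [[Y, Z]].
Proof. by rewrite lie_bracketC linearD opprD -!lie_bracketC. Qed.

Lemma lie_bracketZl a X Y : [[a *: X, Y]] = a *: [[X, Y]].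
Proof. by rewrite lie_bracketC linearZ /= -scalerN -lie_bracketC. Qed.

Lemma lie_bracket0l X : [[0, X]] = 0.
Proof. by rewrite lie_bracketC linear0 oppr0. Qed.

Lemma lie_bracket_suml n (F : 'I_n -> g) X :
  [[\sum_i F i, X]] = \sum_i [[F i, X]].
Proof.
rewrite lie_bracketC linear_sum -sumrN; apply: eq_bigr => i _.
by rewrite -lie_bracketC.
Qed.

Lemma lie_bracketA X Y Z : [[X, [[Y, Z]]]] = [[[[X, Y]], Z]] + [[Y, [[X, Z]]]].
Proof.
have := lie_jacobi X Y Z.
rewrite (lie_bracketC Z X) (lie_bracketC Z [[X, Y]]) linearN /= => /eqP.
by rewrite -addrA -opprD subr_eq0 addrC => /eqP.
Qed.

Lemma adP a X Y : ad (a *: X + Y) = a *: ad X + ad Y.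
Proof.
apply/lfunP => Z; rewrite add_lfunE scale_lfunE !adE.
by rewrite lie_bracketDl lie_bracketZl.
Qed.

Lemma ad_bracket X Y : ad [[X, Y]] = (ad X \o ad Y)%VF - (ad Y \o ad X)%VF.
Proof.
apply/lfunP => Z; rewrite add_lfunE opp_lfunE !comp_lfunE !adE.
by rewrite [in RHS]lie_bracketA addrK.
Qed.

Lemma lfun_trace_is_scalar : scalar (@lfun_trace K g).
Proof. by move=> a f h; rewrite /lfun_trace linearP /= mxtraceD mxtraceZ. Qed.
HB.instance Definition _ :=
  GRing.isLinear.Build K 'End(g) K _ (@lfun_trace K g) lfun_trace_is_scalar.

Lemma lfun_traceC (f h : 'End(g)) :
  lfun_trace (f \o h)%VF = lfun_trace (h \o f)%VF.
Proof. by rewrite /lfun_trace !(mxof_comp _ _ (vbasisP _)) mxtrace_mulC. Qed.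

Lemma killing_formC X Y : killing_form X Y = killing_form Y X.
Proof. exact: lfun_traceC. Qed.

Lemma killing_form_is_scalar X : scalar (killing_form X).
Proof.
move=> a Y Z; rewrite /killing_form adP comp_lfunDr -comp_lfunZr.
by rewrite linearP.
Qed.
HB.instance Definition _ X :=
  GRing.isLinear.Build K g K _ (killing_form X) (killing_form_is_scalar X).

Lemma killing_formDl X Y Z :
  killing_form (X + Y) Z = killing_form X Z + killing_form Y Z.
Proof. by rewrite killing_formC linearD /= !(killing_formC Z). Qed.

Lemma killing_formZl a X Y : killing_form (a *: X) Y = a * killing_form X Y.
Proof. by rewrite killing_formC linearZ /= (killing_formC Y). Qed.

Lemma killing_formNl X Y : killing_form (- X) Y = - killing_form X Y.
Proof. by rewrite killing_formC linearN /= (killing_formC Y). Qed.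

Lemma killing_form_invariant X Y Z :
  killing_form [[X, Y]] Z = killing_form X [[Y, Z]].
Proof.
rewrite /killing_form !ad_bracket comp_lfunDl comp_lfunDr.
rewrite comp_lfunNl comp_lfunNr.
rewrite !linearB /= -!comp_lfunA; congr (_ - _).
by rewrite lfun_traceC comp_lfunA.
Qed.

End KillingForm.

(** * A diagonalizability criterion for matrices *)

Lemma perm_square_factor (T : eqType) (s : seq T) :
  ~~ uniq s -> exists x s', perm_eq s [:: x, x & s'].
Proof.
elim: s => //= x s IHs; rewrite negb_and negbK => /orP[/perm_to_rem xs|+].
  by exists x, (rem x s); rewrite perm_cons.
move/IHs=> [y [s' ps] ]; exists y, (x :: s').
rewrite (perm_trans (y := [:: x, y, y & s'])) ?perm_cons //.
by rewrite (perm_catCA [:: x] [:: y; y]).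
Qed.

(** If [a] were a repeated root of the minimal polynomial, dropping one factor ['X - a%:P] would
    leave [r]; the hypothesis, applied to rows, makes [r] annihilate [M], against minimality. *)
Lemma diagonalizable_squarefree (C : closedFieldType) n (M : 'M[C]_n) :
    (forall a (u : 'rV_n),
       u *m (M - a%:M) *m (M - a%:M) = 0 -> u *m (M - a%:M) = 0) ->
  diagonalizable M.
Proof.
case: n M => [|n] M M_ss.
  by exists 1%:M; rewrite ?unitmx1 //; apply/is_diag_mxP => -[] .
apply/diagonalizableP.
have [rs p_rs] := closed_field_poly_normal (mxminpoly M).
rewrite (monicP (mxminpoly_monic M)) scale1r in p_rs.
exists rs; last by rewrite p_rs.
apply/negPn/negP => /perm_square_factor[a [s prs] ].
pose r := \prod_(x <- s) ('X - x%:P) * ('X - a%:P).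
have r_neq0 : r != 0.
  by rewrite mulf_neq0 ?polyXsubC_eq0 ?monic_neq0 ?monic_prod_XsubC.
have {}p_rs : mxminpoly M = r * ('X - a%:P).
  by rewrite p_rs (perm_big _ prs) /= !big_cons /r; ring.
have hXa : horner_mx M ('X - a%:P) = M - a%:M.
  by rewrite rmorphB /= horner_mx_X horner_mx_C.
have qM0 : horner_mx M (\prod_(x <- s) ('X - x%:P)) *m (M - a%:M)
    *m (M - a%:M) = 0.
  by have := mx_root_minpoly M; rewrite p_rs !rmorphM /= hXa.
have /dvdp_leq : mxminpoly M %| r.
  apply: mxminpoly_min; rewrite rmorphM /= hXa; apply/row_matrixP => i.
  by rewrite row0 [row _ _]row_mul; apply: M_ss; rewrite -!row_mul qM0 row0.
move=> /(_ r_neq0); rewrite p_rs size_Mmonic ?monicXsubC // size_XsubC.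
by rewrite addn2 ltnn.
Qed.

(** * The Hermitian inner product [B X (star Y)] *)

Section CartanInvolution.
Variables (C : numClosedFieldType) (g : lieAlgType C) (star : g -> g).
Implicit Types (X Y Z H : g) (U : {vspace g}).
Local Notation B := killing_form.

Hypothesis B_nondeg : forall X, (forall Y, B X Y = 0) -> X = 0.
Hypothesis starP : forall a X Y, star (a *: X + Y) = a^* *: star X + star Y.
Hypothesis star_inv : involutive star.
Hypothesis star_br : forall X Y, star [[X, Y]] = [[star Y, star X]].
Hypothesis B_star_ge0 : forall X, 0 <= B X (star X).

Lemma starD X Y : star (X + Y) = star X + star Y.
Proof. by have := starP 1 X Y; rewrite rmorph1 !scale1r. Qed.

Lemma star0 : star 0 = 0.
Proof. by apply: (addrI (star 0)); rewrite -starD !addr0. Qed.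

Lemma starZ a X : star (a *: X) = a^* *: star X.
Proof. by have := starP a X 0; rewrite star0 !addr0. Qed.

Lemma starN X : star (- X) = - star X.
Proof. by rewrite -scaleN1r starZ rmorphN1 scaleN1r. Qed.

Lemma star_sum n (F : 'I_n -> g) : star (\sum_i F i) = \sum_i star (F i).
Proof. exact: (big_morph star starD star0). Qed.

(** Polarization: [B Z (star Z)] is real at [Z = X + Y] and at [Z = 'i *: X + Y]. *)
Lemma B_starC X Y : B Y (star X) = (B X (star Y))^*.
Proof.
have real_sq Z : B Z (star Z) \is Num.real by rewrite ger0_real.
have real_cross a : a * B X (star Y) + a^* * B Y (star X) \is Num.real.
  have := real_sq (a *: X + Y).
  rewrite starD starZ linearD /= !killing_formDl !killing_formZl.
  rewrite !linearZ /=.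
  set w := B X (star Y); set w' := B Y (star X).
  set p := B X (star X); set q := B Y (star Y) => realE.
  have -> : a * w + a^* * w' = a * (a^* * p) + a^* * w' + (a * w + q)
    - (a * a^* * p + q) by ring.
  apply: rpredB => //; apply: rpredD; rewrite ?real_sq //.
  by apply: rpredM; rewrite ?real_sq // ger0_real ?mul_conjC_ge0.
have := real_cross 1; have := real_cross 'i.
move: (B X _) (B Y _) => w w'.
rewrite conjCi rmorph1 !mul1r => /CrealP + /CrealP.
rewrite !rmorphD !rmorphM !rmorphN /= conjCi opprK => e1 e2.
have {}e1 : w'^* - w^* = w - w'.
  by apply: (mulfI (neq0Ci C)); rewrite !mulrBr -mulNr addrC e1 mulNr.
have two_neq0 : 2 != 0 :> C by rewrite pnatr_eq0.
rewrite -(conjCK w'); congr (_^*); apply: (mulfI two_neq0).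
rewrite (_ : 2 * w'^* = (w'^* - w^*) + (w^* + w'^*)); last by ring.
by rewrite e1 e2; ring.
Qed.

Lemma star_isometry X Y : B (star X) (star Y) = (B X Y)^*.
Proof. by rewrite killing_formC -[in RHS](star_inv Y) -B_starC. Qed.

(** As in Cauchy-Schwarz, an isotropic vector of a positive semidefinite Hermitian form lies in its
    radical, which is zero because [B] is nondegenerate. *)
Lemma B_star_eq0 X : B X (star X) = 0 -> X = 0.
Proof.
move=> pX0; apply: B_nondeg => Y; rewrite -(star_inv Y).
set Z := star Y; set w := B X (star Z); apply/eqP/negPn/negP => w_neq0.
(* This [a] would make [B (a *: X + Z) (star (a *: X + Z))] negative. *)
pose a := - (B Z (star Z) + 1) / w.
have := B_star_ge0 (a *: X + Z).
rewrite starD starZ linearD /= !killing_formDl !killing_formZl !linearZ /= pX0.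
rewrite (B_starC X Z) -/w mulr0 mulr0 add0r -rmorphM /=.
rewrite /a mulfVK // conj_Creal; last first.
  by rewrite rpredN rpredD ?rpred1 // ger0_real.
rewrite [X in 0 <= X](_ : _ = - (B Z (star Z) + 2)); last by ring.
have two_gt0 : 0 < B Z (star Z) + 2 by rewrite ltr_wpDl.
by rewrite oppr_ge0 => /(lt_le_trans two_gt0); rewrite ltxx.
Qed.

Lemma B_star_gt0 X : X != 0 -> 0 < B X (star X).
Proof.
move=> X_neq0; rewrite lt_def B_star_ge0 andbT.
by apply: contra_neq X_neq0; apply: B_star_eq0.
Qed.

Lemma B_self_real X Y : star X = X -> star Y = Y -> B X Y \is Num.real.
Proof. by move=> sX sY; apply/CrealP; rewrite -star_isometry sX sY. Qed.

Lemma B_self_eq0 X : star X = X -> B X X = 0 -> X = 0.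
Proof. by move=> sX; rewrite -{2}sX; apply: B_star_eq0. Qed.

(** [ad (star X)] is the Hermitian adjoint of [ad X]: the reversal of brackets by [star] cancels the
    sign coming from invariance. *)
Lemma B_adjoint X Y Z : B [[X, Y]] (star Z) = B Y (star [[star X, Z]]).
Proof.
by rewrite lie_bracketC killing_formNl killing_form_invariant star_br star_inv
  (lie_bracketC X) linearN opprK.
Qed.

(** Normality shows that first [f' (f X)] and then [f X] has norm zero. *)
Lemma normal_squarefree (f f' : g -> g) :
    (forall X Y, B (f X) (star Y) = B X (star (f' Y))) ->
    (forall X, f (f' X) = f' (f X)) -> f' 0 = 0 ->
  forall X, f (f X) = 0 -> f X = 0.
Proof.
move=> adj comm f'0 X ffX0.
have adj' Y Z : B (f' Y) (star Z) = B Y (star (f Z)).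
  by rewrite B_starC -adj -B_starC.
have f'fX0 : f' (f X) = 0.
  by apply: B_star_eq0; rewrite adj' comm ffX0 f'0 star0 linear0.
by apply: B_star_eq0; rewrite adj f'fX0 star0 linear0.
Qed.

(** * Maximal abelian subspaces stable under [star] *)

Definition centralizes X U := forall H, H \in U -> [[H, X]] = 0.

Definition abelian_star_stable U :=
  (forall H H', H \in U -> H' \in U -> [[H, H']] = 0) /\
  (forall H, H \in U -> star H \in U).

Lemma centralizes_star U X :
  abelian_star_stable U -> centralizes X U -> centralizes (star X) U.
Proof.
move=> [_ stU] XU H HU; rewrite -(star_inv H) -star_br lie_bracketC XU ?stU //.
by rewrite oppr0 star0.
Qed.

Lemma centralizesP a X Y U :
  centralizes X U -> centralizes Y U -> centralizes (a *: X + Y) U.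
Proof. by move=> XU YU H HU; rewrite linearP /= XU ?YU // scaler0 addr0. Qed.

(** Both [X + star X] and ['i *: (X - star X)] are self-adjoint and centralize [U]; they cannot both
    lie in [U], since [X] is a combination of them. *)
Lemma split_self_adjoint U X :
    abelian_star_stable U -> centralizes X U -> X \notin U ->
  exists Y, [/\ star Y = Y, centralizes Y U & Y \notin U].
Proof.
move=> goodU XU; have X'U := centralizes_star goodU XU.
have [sumU XnU|sumnU _] := boolP (X + star X \in U); last first.
  exists (X + star X); rewrite starD star_inv addrC; split=> //.
  by rewrite -[star X]scale1r addrC; exact: centralizesP.
exists ('i *: (X - star X)); split.
- by rewrite starZ starD starN star_inv conjCi scaleNr -scalerN opprB.
- rewrite scalerBr addrC -scaleNr; apply: centralizesP => //.
  by rewrite -[_ *: _]addr0; apply: centralizesP => // H _; rewrite linear0.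
apply: contra XnU => difU.
have -> : X = 2^-1 *: ((X + star X) - 'i *: ('i *: (X - star X))).
  rewrite scalerA -expr2 sqrCi scaleN1r opprK addrACA subrr addr0.
  by rewrite -mulr2n -scaler_nat scalerA mulVf ?scale1r // pnatr_eq0.
by rewrite memvZ // memvB // memvZ.
Qed.

Lemma maximal_abelian A : star A = A -> exists U,
  [/\ abelian_star_stable U, A \in U & forall X, centralizes X U -> X \in U].
Proof.
move=> sA.
have : exists2 U, abelian_star_stable U & A \in U.
  exists <[A]>%VS; last exact: memv_line.
  split=> [H H' /vlineP[a ->] /vlineP[b ->]|H /vlineP[a ->] ].
    by rewrite lie_bracketZl linearZ /= lie_bracketxx !scaler0.
  by rewrite starZ sA memvZ ?memv_line.
(* Induction on the codimension of [U]: as long as the centralizer [Z] is not inside [U], a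
   self-adjoint element of [Z] outside [U] is adjoined. *)
move=> [U]; have [k] := ubnP (\dim {:g} - \dim U).
elim: k U => // k IHk U; rewrite ltnS => leUk [abU stU] AU.
pose Z := (\bigcap_(i < \dim U) lker (ad (vbasis U)`_i))%VS.
have ZP X : reflect (centralizes X U) (X \in Z).
  apply: (iffP idP) => [XZ H HU|XU].
    rewrite (coord_vbasis HU) lie_bracket_suml big1 // => i _.
    rewrite lie_bracketZl -adE.
    have : X \in lker (ad (vbasis U)`_i) by apply: subvP XZ; apply: bigcapv_inf.
    by rewrite memv_ker => /eqP ->; rewrite scaler0.
  rewrite memvE; apply/subv_bigcapP => i _.
  by rewrite -memvE memv_ker adE XU // vbasis_mem ?mem_nth ?size_tuple.
have [ZU|/subvPn[X /ZP XU XnU] ] := boolP (Z <= U)%VS.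
  by exists U; split=> // X /ZP XZ; apply: subvP XZ.
have {X XU XnU}[X [sX XU XnU] ] := split_self_adjoint (conj abU stU) XU XnU.
apply: (IHk (U + <[X]>)%VS); last exact: subvP (addvSl _ _) _ AU.
  have ltU : (\dim U < \dim (U + <[X]>))%N.
    rewrite (ltn_leqif (dimv_leqif_sup (addvSl _ _))); apply: contra XnU.
    by move/subvP; apply; rewrite (subvP (addvSr _ _)) // memv_line.
  apply: leq_trans leUk; apply: ltn_sub2l => //.
  by rewrite (leq_trans ltU) ?dimvS ?subvf.
split=> [H H' |H] /memv_addP[K KU [_ /vlineP[a ->] ->] ]; last first.
  by rewrite starD starZ sX memv_add ?stU // memvZ ?memv_line.
move=> /memv_addP[L LU [_ /vlineP[b ->] ->] ].
rewrite linearD linearZ /= !lie_bracketDl !lie_bracketZl lie_bracketxx abU //.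
by rewrite XU // (lie_bracketC X L) XU // !(oppr0, scaler0, addr0).
Qed.

(** * Simultaneous diagonalization of [ad H] for [H] in [U] *)

Let e := vbasis {:g}.
Let e_basis : basis_of {:g} e := vbasisP {:g}.
Let adm H := mxof e e (ad H).

Lemma adm_diagonalizable U H :
  abelian_star_stable U -> H \in U -> diagonalizable (adm H).
Proof.
move=> [abU stU] HU; apply: diagonalizable_squarefree => a u.
(* [f'] is the adjoint of [f]; the two commute because [U] is abelian and contains [star H]. *)
pose f Z := [[H, Z]] - a *: Z; pose f' Z := [[star H, Z]] - a^* *: Z.
have fE u' : u' *m (adm H - a%:M) = rVof e (f (vecof e u')).
  rewrite mulmxBr mul_mxof mul_mx_scalar adE /f [RHS]linearB /=.
  by rewrite [in RHS]linearZ /= vecofK.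
rewrite !fE rVofK // => /eqP; rewrite rVof_eq0 // => /eqP ffu0.
suff -> : f (vecof e u) = 0 by rewrite linear0.
apply: (normal_squarefree (f' := f')) ffu0 => [X Y|X|].
- rewrite /f /f' killing_formDl killing_formNl killing_formZl B_adjoint.
  by rewrite starD starN starZ conjCK linearB linearZ.
- rewrite /f /f' !linearB !linearZ /= (lie_bracketA H) (abU H) ?stU //
    lie_bracket0l add0r.
  by rewrite addrACA !scalerA (mulrC a).
- by rewrite /f' linear0 scaler0 subr0.
Qed.

Lemma joint_eigenbasis U : abelian_star_stable U ->
  exists v : 'I_(\dim {:g}) -> g, [/\ forall k, v k != 0,
    forall X, exists x, X = \sum_k x k *: v k &
    forall k H, H \in U -> exists c, [[H, v k]] = c *: v k].
Proof.
move=> goodU; have [abU stU] := goodU.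
have [P Pu /allP PD] : codiagonalizable [seq adm b | b <- vbasis U].
  apply/codiagonalizableP; split=> [_ _ /mapP[H HU ->] /mapP[H' H'U ->]|].
    have /vbasis_mem {}HU := HU; have /vbasis_mem {}H'U := H'U.
    rewrite /comm_mx -!(mxof_comp _ _ e_basis); congr mxof; apply/lfunP => X.
    by rewrite !comp_lfunE !adE lie_bracketA (abU H') // lie_bracket0l add0r.
  by move=> _ /mapP[H HU ->]; apply: adm_diagonalizable goodU (vbasis_mem HU).
(* Matrices act on row vectors, so the rows of [P] are the coordinates of joint eigenvectors. *)
exists (fun k => vecof e (row k P)); split=> [k|X|k H HU].
- rewrite vecof_eq0 //; apply/eqP => Pk0.
  have /rowP/(_ k) : delta_mx 0 k = 0 :> 'rV[C]_(\dim {:g}).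
    by rewrite -[LHS](mulmxK Pu) -rowE Pk0 mul0mx.
  by rewrite !mxE !eqxx => /eqP; rewrite oner_eq0.
- exists ((rVof e X *m invmx P) 0); rewrite -[LHS](rVofK e_basis).
  rewrite -[rVof e X in LHS](mulmxKV Pu) mulmx_sum_row linear_sum /=.
  by apply: eq_bigr => i _; rewrite linearZ.
- apply/vlineP; rewrite (coord_vbasis HU) lie_bracket_suml memv_suml // => i _.
  rewrite lie_bracketZl memvZ // -adE.
  have /PD/= /similar_diagPex[D /(similarP Pu) PM] :
      adm (vbasis U)`_i \in [seq adm b | b <- vbasis U].
    by rewrite map_f // mem_nth // size_tuple.
  rewrite (hom_vecof _ e_basis) -row_mul PM row_mul row_diag_mx.
  rewrite -scalemxAl -rowE linearZ /=.
  by rewrite memvZ // memv_line.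
Qed.

(** * Orthogonal projection, obtuse families and dominance *)

(** The family may be linearly dependent. The Gram system is still solvable: a kernel vector of [G]
    gives a combination of norm zero, hence zero, so it pairs to [0] with [A]. *)
Lemma gram_projection n (f : 'I_n -> g) A :
    (forall k, star (f k) = f k) -> star A = A ->
  exists2 c : 'I_n -> C, forall k, c k \is Num.real &
    forall j, B (A - \sum_k c k *: f k) (f j) = 0.
Proof.
move=> sf sA; pose G := \matrix_(i, j) B (f i) (f j).
pose a := \row_j B A (f j).
have /submxP[D aE] : (a <= G)%MS.
  rewrite submxE; apply/eqP/rowP => j; rewrite !mxE.
  pose c k := cokermx G k j; pose X := \sum_k c k *: f k.
  have fX0 i : B (f i) X = 0.
    have := congr1 (fun M : 'M_ _ => M i j) (mulmx_coker G); rewrite !mxE => <-.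
    by rewrite linear_sum; apply: eq_bigr => k _; rewrite linearZ mxE mulrC.
  have X0 : X = 0.
    apply: B_star_eq0; rewrite star_sum linear_sum big1 // => k _.
    by rewrite starZ sf linearZ /= killing_formC fX0 mulr0.
  transitivity (B A X); last by rewrite X0 linear0.
  by rewrite linear_sum; apply: eq_bigr => k _; rewrite linearZ mxE mulrC.
(* [G] and [a] have real entries, so the real part of a solution is again a solution. *)
exists (fun k => 'Re (D 0 k)) => [k|j]; first exact: Creal_Re.
apply/eqP; rewrite killing_formDl killing_formNl subr_eq0; apply/eqP.
have /rowP/(_ j) := aE; rewrite !mxE => afE.
have /Creal_ReP <- := B_self_real sA (sf j).
rewrite afE raddf_sum killing_formC linear_sum /=; apply: eq_bigr => k _.
by rewrite linearZ /= mxE ReMr ?B_self_real // killing_formC mulrC.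
Qed.

Lemma obtuse_cone n (f : 'I_n -> g) (c : 'I_n -> C) A :
    (forall k, star (f k) = f k) -> (forall k, c k \is Num.real) ->
    (forall i j, i != j -> B (f i) (f j) <= 0) ->
    A = \sum_k c k *: f k -> (forall j, 0 <= B A (f j)) ->
  exists2 c' : 'I_n -> C, forall k, 0 <= c' k & A = \sum_k c' k *: f k.
Proof.
move=> sf c_real obtuse AE A_ge0.
(* With [A = P - M] the positive and negative parts of the combination,
   [B M M = B P M - B A M <= 0]. *)
pose p k := if 0 <= c k then c k else 0.
pose m k := if 0 <= c k then 0 else - c k.
have p_ge0 k : 0 <= p k by rewrite /p; case: ifP.
have m_ge0 k : 0 <= m k.
  by rewrite /m; case: ifPn => //; rewrite -real_ltNge // oppr_ge0 => /ltW.
have pm0 k : p k * m k = 0.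
  by rewrite /p /m; case: ifP => _; rewrite ?mulr0 ?mul0r.
pose P := \sum_k p k *: f k; pose M := \sum_k m k *: f k.
have {}AE : A = P - M.
  rewrite AE -sumrB; apply: eq_bigr => k _; rewrite -scalerBl; congr (_ *: _).
  by rewrite /p /m; case: ifP => _; rewrite ?subr0 // sub0r opprK.
have sM : star M = M.
  by rewrite star_sum; apply: eq_bigr => k _; rewrite starZ sf geC0_conj.
have PM_le0 : B P M <= 0.
  rewrite linear_sum sumr_le0 // => j _.
  rewrite linearZ /= killing_formC linear_sum mulr_sumr sumr_le0 // => i _.
  rewrite linearZ /= mulrA; have [->|ij] := eqVneq i j.
    by rewrite (mulrC (m j)) pm0 mul0r.
  by rewrite mulr_ge0_le0 ?mulr_ge0 // obtuse // eq_sym.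
have AM_ge0 : 0 <= B A M.
  by rewrite linear_sum sumr_ge0 // => j _; rewrite linearZ /= mulr_ge0.
have M0 : M = 0.
  apply: B_self_eq0 => //; apply/eqP; rewrite eq_le -{4}sM B_star_ge0 andbT.
  rewrite -[M in B M _](subKr P) -AE killing_formDl killing_formNl.
  by rewrite subr_le0 (le_trans PM_le0).
by exists p => //; rewrite AE M0 subr0.
Qed.

(** Any real [N] above all the ratios [|y k / x k|] works; ratios with [x k = 0] are zero by the
    convention on division. *)
Lemma dominating_multiplier n (x y : 'I_n -> C) :
    (forall k, x k \is Num.real) -> (forall k, y k \is Num.real) ->
  exists2 N : C, N \is Num.real &
    forall k, x k != 0 -> 0 < x k * (N * x k + y k).
Proof.
move=> x_real y_real; exists (\sum_k `|y k / x k| + 1) => [|k xk_neq0].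
  by rewrite rpredD ?rpred1 // rpred_sum // => k _; apply: normr_real.
set N := _ + 1; have -> : x k * (N * x k + y k) = x k ^+ 2 * (N + y k / x k).
  by field.
rewrite mulr_gt0 ?real_exprn_even_gt0 //.
have yx_real : y k / x k \is Num.real by rewrite rpred_div.
rewrite addrAC ltr_wpDl ?ltr01 // -[y k / x k]opprK subr_ge0.
have le_norm : - (y k / x k) <= `|y k / x k|.
  by rewrite -normrN real_ler_norm ?rpredN.
by rewrite (le_trans le_norm) // (bigD1 k) //= lerDl sumr_ge0.
Qed.

(** Perturbs [A] off all hyperplanes orthogonal to a nonzero [h k], keeping the signs that [A] had;
    [A] is then dominant for the positive roots defined by [T]. *)
Lemma dominant_regular n (h : 'I_n -> g) U A :
    (forall k, star (h k) = h k) -> (forall k, h k \in U) ->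
    star A = A -> A \in U ->
  exists T, [/\ star T = T, T \in U,
    forall k, B (h k) A != 0 -> 0 < B (h k) A * B (h k) T &
    forall k, h k != 0 -> B (h k) T != 0].
Proof.
move=> sh hU sA AU.
suff [T [sT TU TA Treg] ] : exists T, [/\ star T = T, T \in U,
    forall k, B (h k) A != 0 -> 0 < B (h k) A * B (h k) T &
    forall k, k \in enum 'I_n -> h k != 0 -> B (h k) T != 0].
  by exists T; split=> // k; apply: Treg; rewrite mem_enum.
elim: (enum 'I_n) => [|j l [T [sT TU TA Treg] ] ].
  exists A; split=> // k hA_neq0.
  by rewrite -expr2 real_exprn_even_gt0 // B_self_real.
have hT_real k : B (h k) T \is Num.real by apply: B_self_real.
have hj_real k : B (h k) (h j) \is Num.real by apply: B_self_real.
have [N N_real NP] := dominating_multiplier hT_real hj_real.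
have hT'E k : B (h k) (N *: T + h j) = N * B (h k) T + B (h k) (h j).
  by rewrite linearP.
(* For large [N], adding [h j] to [N *: T] changes no sign already fixed. *)
exists (N *: T + h j); split=> [||k hA_neq0|k].
- by rewrite starP sT sh conj_Creal.
- by rewrite memvD ?memvZ.
- have aT_gt0 := TA k hA_neq0.
  have hT_neq0 : B (h k) T != 0.
    by apply: contraTneq aT_gt0 => ->; rewrite mulr0 ltxx.
  have := mulr_gt0 aT_gt0 (NP k hT_neq0); rewrite -hT'E.
  rewrite (_ : _ * _ * _ = B (h k) T ^+ 2 *
    (B (h k) A * B (h k) (N *: T + h j))); last by ring.
  by rewrite pmulr_rgt0 // real_exprn_even_gt0.
have [hT0|hT_neq0 _ _] := eqVneq (B (h k) T) 0; last first.
  have := NP k hT_neq0; rewrite -hT'E; apply: contraTneq => ->.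
  by rewrite mulr0 ltxx.
rewrite inE => /predU1P[kj|kl hk_neq0] /=; last first.
  by have := Treg k kl hk_neq0; rewrite hT0 eqxx.
(* Where [T] vanished on [h j], the new value is [B (h j) (h j)], nonzero by definiteness. *)
rewrite hT'E hT0 mulr0 add0r -kj => hk_neq0.
by apply: contra_neq hk_neq0; apply: B_self_eq0.
Qed.

(** * Roots with respect to [U] *)

Section Roots.
Variables (U : {vspace g}).
Hypotheses (U_good : abelian_star_stable U).
Hypothesis (U_max : forall X, centralizes X U -> X \in U).

Let abU := proj1 U_good.
Let stU := proj2 U_good.

(** A weight is encoded by an element of [g] representing the linear functional through the Killing
    form. *)
Definition weight h X := forall H, H \in U -> [[H, X]] = B H h *: X.

(** For a root vector [X] this represents the root itself through [B]; the usual coroot is a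
    positive multiple of it. *)
Definition coroot X := (B X (star X))^-1 *: [[X, star X]].

Lemma star_coroot X : star (coroot X) = coroot X.
Proof. by rewrite starZ star_br star_inv geC0_conj ?invr_ge0. Qed.

Lemma star_bracket_star H X : [[H, star X]] = - star [[star H, X]].
Proof. by rewrite star_br star_inv lie_bracketC. Qed.

(** The eigenvalues of [H] on [X] and [star X] are opposite, so [[[X, star X]]] centralizes [U] and
    lies in [U] by maximality; invariance of [B] gives the weight. *)
Lemma coroot_weight X :
    X != 0 -> (forall H, H \in U -> exists c, [[H, X]] = c *: X) ->
  coroot X \in U /\ weight (coroot X) X.
Proof.
move=> X_neq0 eigX; have XX_gt0 := B_star_gt0 X_neq0.
have XX_neq0 : B X (star X) != 0 by rewrite gt_eqF.
split=> [|H HU].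
  apply: memvZ; apply: U_max => H HU.
  have [c cE] := eigX H HU; have [c' c'E] := eigX _ (stU HU).
  have -> : [[H, [[X, star X]]]] = (c - c'^*) *: [[X, star X]].
    rewrite lie_bracketA (star_bracket_star H) cE c'E starZ -scaleNr linearZ /=.
    by rewrite lie_bracketZl -scalerDl.
  have := B_adjoint H X X; rewrite cE c'E starZ killing_formZl linearZ /=.
  by move/(mulIf XX_neq0) => ->; rewrite subrr scale0r.
have [c cE] := eigX H HU; rewrite cE; congr (_ *: _).
rewrite linearZ /= -killing_form_invariant cE killing_formZl mulrC mulfK //.
Qed.

Lemma weight_star h X : star h = h -> weight h X -> weight (- h) (star X).
Proof.
move=> sh hX H HU; rewrite star_bracket_star hX ?stU // starZ linearN scaleNr.
by rewrite -star_isometry star_inv sh.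
Qed.

Lemma weight_bracket h k X Y :
  weight h X -> weight k Y -> weight (h + k) [[X, Y]].
Proof.
move=> hX kY H HU; rewrite lie_bracketA (hX H) // (kY H) // lie_bracketZl.
by rewrite linearZ /= -scalerDl linearD.
Qed.

Lemma U_form_nondeg X :
  X \in U -> star X = X -> (forall H, H \in U -> B H X = 0) -> X = 0.
Proof. by move=> XU sX HX0; apply: B_self_eq0 (HX0 _ _). Qed.

Variables (n : nat) (v : 'I_n -> g).
Hypothesis v_neq0 : forall k, v k != 0.
Hypothesis v_span : forall X, exists x, X = \sum_k x k *: v k.
Variable h : 'I_n -> g.
Hypothesis hU : forall k, h k \in U.
Hypothesis sh : forall k, star (h k) = h k.
Hypothesis hv : forall k, weight (h k) (v k).
Hypothesis h_coroot :
  forall k, [[v k, star (v k)]] = B (v k) (star (v k)) *: h k.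

(** Vectors of different weights are orthogonal, while a nonzero [X] cannot be orthogonal to the
    whole spanning family [v]. *)
Lemma weight_root l X :
  l \in U -> star l = l -> X != 0 -> weight l X -> exists k, h k = l.
Proof.
move=> lU sl X_neq0 lX.
have [k vX_neq0] : exists k, B (v k) (star X) != 0.
  apply/existsP; apply: contraNT X_neq0; rewrite negb_exists => /forallP vX0.
  apply/eqP/B_star_eq0; have [x {1}->] := v_span X.
  rewrite killing_formC linear_sum big1 // => k _.
  have /negPn/eqP := vX0 k; rewrite linearZ /= killing_formC => ->.
  by rewrite mulr0.
exists k; apply/eqP; rewrite -subr_eq0; apply/eqP; apply: U_form_nondeg.
- by rewrite memvB.
- by rewrite starD starN sh sl.
move=> H HU; have := B_adjoint H (v k) X.
rewrite hv // lX ?stU // starZ killing_formZl linearZ /= => /(mulIf vX_neq0) hl.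
by rewrite linearB /= hl -star_isometry star_inv sl subrr.
Qed.

(** Such an [X] kills every [v k], so [ad X = 0] and [X] lies in the radical of [B]. *)
Lemma roots_separate X : X \in U -> (forall k, B X (h k) = 0) -> X = 0.
Proof.
move=> XU Xh0; apply: B_nondeg => Y.
suff adX0 : ad X = 0 by rewrite /killing_form adX0 comp_lfun0l linear0.
apply/lfunP => Z; rewrite adE zero_lfunE; have [x ->] := v_span Z.
rewrite linear_sum big1 // => k _.
by rewrite linearZ /= hv // Xh0 scale0r scaler0.
Qed.

Lemma opp_root k : exists l, h l = - h k.
Proof.
apply: (@weight_root _ (star (v k))).
- by rewrite memvN.
- by rewrite starN sh.
- by apply: contra_neq (v_neq0 k) => sv0; rewrite -[v k]star_inv sv0 star0.
- exact: weight_star.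
Qed.

(** * Positive and simple roots *)

Variables A T : g.
Hypotheses (sA : star A = A) (AU : A \in U) (sT : star T = T).
Hypothesis T_dominates : forall k, B (h k) A != 0 -> 0 < B (h k) A * B (h k) T.
Hypothesis T_regular : forall k, h k != 0 -> B (h k) T != 0.

Definition positive k := 0 < B (h k) T.

(* Nothing rules out [h i = h k] with [i <> k] here; the last condition keeps
   one index per root. *)
Definition simple k := [&& positive k,
  [forall i, forall j, positive i && positive j ==> (h k != h i + h j)] &
  [forall i, (h i == h k) ==> (k <= i)%N] ].

Let hT_real k : B (h k) T \is Num.real. Proof. exact: B_self_real. Qed.

Lemma root_sign k :
  h k != 0 -> positive k \/ exists2 l, positive l & h l = - h k.
Proof.
move=> /T_regular hT_neq0; have [hT|hT|hT0] := real_ltgt0P (hT_real k).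
- by left.
- right; have [l hl] := opp_root k; exists l => //.
  by rewrite /positive hl killing_formNl oppr_gt0.
- by rewrite hT0 eqxx in hT_neq0.
Qed.

Lemma simple_indecomposable k i j :
  simple k -> positive i -> positive j -> h k <> h i + h j.
Proof.
move=> /and3P[_ /forallP/(_ i)/forallP/(_ j) + _] pi pj.
by rewrite pi pj => /eqP.
Qed.

Lemma simple_inj i j : simple i -> simple j -> h i = h j -> i = j.
Proof.
move=> /and3P[_ _ /forallP/(_ j) ij] /and3P[_ _ /forallP/(_ i) ji] hij.
apply/val_inj/eqP; rewrite eqn_leq.
by move: ij ji; rewrite hij eqxx /= => -> ->.
Qed.

(** A nonzero bracket would be a root vector for [h i - h j]; according to the sign of this root,
    [h i] or [h j] would be a sum of two positive roots. *)
Lemma simple_bracket0 i j :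
  simple i -> simple j -> i != j -> [[v i, star (v j)]] = 0.
Proof.
move=> si sj ij; have [pi _ _] := and3P si; have [pj _ _] := and3P sj.
apply/eqP/negPn/negP => X_neq0.
have [k hk] : exists k, h k = h i - h j.
  apply: (weight_root _ _ X_neq0).
  - by rewrite memvB.
  - by rewrite starD starN !sh.
  - by apply: weight_bracket (hv i) _; apply: weight_star.
have hk_neq0 : h k != 0.
  rewrite hk subr_eq0; apply: contra_neq ij; exact: simple_inj.
have [pk|[l pl hl] ] := root_sign hk_neq0.
  by apply: (simple_indecomposable si pj pk); rewrite hk addrC subrK.
by apply: (simple_indecomposable sj pi pl); rewrite hl hk opprB addrC subrK.
Qed.

Lemma simple_obtuse i j : simple i -> simple j -> i != j -> B (h i) (h j) <= 0.
Proof.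
move=> si sj ij; have vi_gt0 := B_star_gt0 (v_neq0 i).
have vj_gt0 := B_star_gt0 (v_neq0 j).
have := lie_bracketA (v i) (star (v i)) (v j).
have -> : [[star (v i), v j]] = 0.
  by rewrite lie_bracketC simple_bracket0 ?oppr0 // eq_sym.
(* Pairing with [v j], the identity becomes
   [B (v i) (v i)^* * B (h i) (h j) * B (v j) (v j)^* = - B Z Z^*],
   where [Z = [v i, v j]]. *)
rewrite linear0 h_coroot lie_bracketZl hv //.
move=> /esym/(congr1 (fun X : g => B X (star (v j)))) /=.
rewrite killing_formDl !killing_formZl B_adjoint star_inv.
rewrite (killing_formC 0) linear0.
move/eqP; rewrite addr_eq0 => /eqP eq_obtuse.
rewrite -(pmulr_lle0 _ vj_gt0) -(pmulr_rle0 _ vi_gt0) eq_obtuse oppr_le0.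
exact: B_star_ge0.
Qed.

(** A positive root of least [T]-value not orthogonal to [D] is simple: in a decomposition both
    summands have smaller [T]-value, hence are orthogonal to [D]. *)
Lemma simple_roots_separate D : D \in U -> star D = D ->
  (forall k, simple k -> B D (h k) = 0) -> D = 0.
Proof.
move=> DU sD D_simple; apply: roots_separate => // k.
have D_positive l : positive l -> B D (h l) = 0.
  move=> pl; apply/eqP/negPn/negP => Dl.
  pose bad l := positive l && (B D (h l) != 0).
  have bad_l : bad l by rewrite /bad pl.
  case: (real_arg_minP bad_l (fun l _ => hT_real l)) => {pl Dl bad_l}m.
  move=> /andP[pm Dm] m_min.
  (* Among the indices giving the same root, the least one meets the last condition of [simple]. *)
  have [r /eqP hr r_min] :=
    arg_minnP (P := fun r => h r == h m) val (eqxx (h m)).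
  have Dpos_lt p : positive p -> B (h p) T < B (h m) T -> B D (h p) = 0.
    move=> pp lt_pm; apply/eqP/negPn/negP => Dp.
    have /m_min : bad p by rewrite /bad pp.
    by move/(lt_le_trans lt_pm); rewrite ltxx.
  case/negP: (Dm); rewrite -hr D_simple //; apply/and3P; split.
  - by rewrite /positive hr.
  - apply/forallP => i; apply/forallP => j; apply/implyP => /andP[pi pj].
    apply/negP => /eqP; rewrite hr => hm; case/negP: Dm.
    rewrite hm linearD /= !Dpos_lt ?addr0 // hm killing_formDl.
      by rewrite ltrDr.
    by rewrite ltrDl.
  - by apply/forallP => i; apply/implyP; rewrite hr => /r_min.
have [->|/root_sign[pk|[l pl hl] ] ] := eqVneq (h k) 0; first exact: linear0.
  exact: D_positive.
by rewrite -[h k]opprK -hl linearN /= D_positive // oppr0.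
Qed.

(** * Writing [A] as a bracket *)

Lemma dominant_bracket : exists Y, A = [[star Y, Y]].
Proof.
(* Padding with [0] keeps the index type ['I_n] and preserves the sign conditions of
   [obtuse_cone]. *)
pose f k := if simple k then h k else 0.
have sf k : star (f k) = f k by rewrite /f; case: ifP; rewrite ?star0.
have fU k : f k \in U by rewrite /f; case: ifP; rewrite ?mem0v.
have [c c_real cP] := gram_projection sf sA.
(* The remainder of the projection is orthogonal to every simple root, hence zero. *)
have AE : A = \sum_k c k *: f k.
  apply/eqP; rewrite -subr_eq0; apply/eqP; apply: simple_roots_separate.
  - by rewrite memvB // memv_suml // => k _; rewrite memvZ.
  - rewrite starD starN sA star_sum; congr (_ - _).
    by apply: eq_bigr => k _; rewrite starZ sf conj_Creal.
  - by move=> k sk; have := cP k; rewrite /f sk.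
have [|j|{c c_real cP AE}c c_ge0 AE] := obtuse_cone sf c_real _ AE.
- move=> i j ij; rewrite /f.
  case: ifP => [si|_]; last by rewrite killing_formC linear0.
  by case: ifP => [sj|_]; rewrite ?linear0 // simple_obtuse.
- rewrite /f; case: ifP => [/and3P[pj _ _]|_]; last by rewrite linear0.
  rewrite killing_formC; have [->//|/T_dominates] := eqVneq (B (h j) A) 0.
  by rewrite pmulr_lgt0 // => /ltW.
pose s k := if simple k then sqrtC (c k / B (v k) (star (v k))) else 0.
have s_ge0 k : 0 <= s k.
  by rewrite /s; case: ifP => // _; rewrite sqrtC_ge0 divr_ge0.
exists (\sum_k s k *: star (v k)).
rewrite star_sum lie_bracket_suml {1}AE; apply: eq_bigr => i _.
rewrite starZ star_inv geC0_conj // lie_bracketZl linear_sum /=.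
rewrite [s i]/s [f i]/f; case: ifP => [si|_]; last by rewrite scale0r scaler0.
rewrite (bigD1 i) //= big1 ?addr0 => [|j ji]; rewrite linearZ /=.
  rewrite h_coroot /s si !scalerA -expr2 sqrtCK divfK //.
  by rewrite gt_eqF // B_star_gt0.
rewrite /s; case: ifP => [sj|_]; last by rewrite scale0r.
by rewrite simple_bracket0 ?scaler0 // eq_sym.
Qed.

End Roots.

Lemma self_adjoint_bracket A : star A = A -> exists Y, A = [[star Y, Y]].
Proof.
move=> sA; have [U [goodU AU U_max] ] := maximal_abelian sA.
have [v [v_neq0 v_span v_eigen] ] := joint_eigenbasis goodU.
pose h k := coroot (v k).
have sh k : star (h k) = h k by apply: star_coroot.
have hU k : h k \in U.
  by case: (coroot_weight goodU U_max (v_neq0 k) (v_eigen k)).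
have hv k : weight U (h k) (v k).
  by case: (coroot_weight goodU U_max (v_neq0 k) (v_eigen k)).
have [T [sT TU T_dom T_reg] ] := dominant_regular sh hU sA AU.
apply: (dominant_bracket goodU v_neq0 v_span hU sh hv _ sA AU sT T_dom T_reg).
by move=> k; rewrite scalerA divff ?scale1r // gt_eqF // B_star_gt0.
Qed.

End CartanInvolution.

Theorem proposition4p16 (R : realType) (g : lieAlgType R[i])
    (g_semisimple : semisimple g)
    (star : g -> g) (star_cartan : cartan_involution star) :
  forall A : g, A = star A -> exists Y : g, A = [[star Y, Y]].
Proof.
case: star_cartan => starP star_inv star_br star_ge0 A sA.
(* [conjc] is convertible with the conjugation [^*] of the closed field structure on [R[i]]. *)
exact: (@self_adjoint_bracket R[i] g star g_semisimple starP star_inv star_br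
  star_ge0 A (esym sA)).
Qed.
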